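(* Let $\alpha\ge 1$ be an integer and let $F=N(\alpha)$, i.e. $n_F=n\,\alpha^{n-1}$ for $n\ge 1$ and $0_F=0$ (so $1_F=1$). Let $A_\alpha(n)$ denote the number of labeled acyclic $\alpha$-multi digraphs with $n$ vertices, with $A_\alpha(0)=1$. Then for every positive integer $n$ $$A_\alpha(n)=(-1)^n\binom{n}{0}_F^{-1}=\left|\binom{n}{0}_F^{-1}\right|,$$ where $\binom{n}{k}_F^{-1}$ denotes the $(n,k)$ entry of the inverse of the matrix of $F$-nomial coefficients.
   Context: For a sequence $F=\{n_F\}_{n\ge0}$ put $0_F!=1$, $n_F!=n_F\cdot(n-1)_F\cdots 1_F$, and for $0\le k\le n$ define the $F$-nomial coefficient $\binom{n}{k}_F=\frac{n_F!}{k_F!\,(n-k)_F!}$, with $\binom{n}{k}_F=0$ for $k>n$. The sequence $N(\alpha)$ is the sequence of coefficients $n_F=[x^n]\,\frac{x}{(1-\alpha x)^2}$. The infinite matrix $\left[\binom{i}{j}_F\right]_{i,j\ge0}$ is lower triangular with ones on the diagonal, hence invertible; $\binom{i}{j}_F^{-1}$ denotes the $(i,j)$ entry of its inverse matrix (not the reciprocal of the number $\binom{i}{j}_F$). An acyclic $\alpha$-multi digraph ($\alpha$-DAG) is a directed multigraph with no directed cycles (in particular no loops) in which any two vertices are connected by at most $\alpha-1$ directed (indistinguishable parallel) edges. Labeled means that the vertex set is $\{1,\dots,n\}$ and different multigraphs on this set are counted as different. *)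

(* Defs.v *)
From HB Require Import structures.
From mathcomp Require Import all_boot all_order all_algebra ring.

Set Implicit Arguments.
Unset Strict Implicit.
Unset Printing Implicit Defensive.

Import Order.TTheory GRing.Theory Num.Theory.

Local Open Scope ring_scope.

Definition infmx := nat -> nat -> rat.

Definition infmx1 : infmx := fun i j => (i == j)%:R.

Definition unitriangular (A : infmx) : Prop :=
  (forall i, A i i = 1) /\ (forall i j, (i < j)%N -> A i j = 0).

(* Product of infinite matrices whose left factor is lower triangular: the
   terms with k > i of the row-by-column sum vanish. *)
Definition infmx_mul (A B : infmx) : infmx :=
  fun i j => \sum_(k < i.+1) A i k * B k j.

(* Inverse of a unitriangular infinite matrix. Row i of the inverse only
   involves the leading block of order i + 1, so that it can be read off the
   inverse of that finite block; [infmx_mulVr], [infmx_mulrV] and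
   [infmx_inv_uniq] below show that this is the two-sided inverse. *)
Definition infmx_inv (A : infmx) : infmx := fun i j =>
  if (j <= i)%N
  then invmx (\matrix_(k < i.+1, l < i.+1) A k l) (inord i) (inord j)
  else 0.

Lemma infmx_mulVr (A : infmx) : unitriangular A ->
  forall i j, infmx_mul (infmx_inv A) A i j = infmx1 i j.
Proof.
move=> [A1 A0] i j; rewrite /infmx_mul /infmx1.
have [lt_ij | le_ji] := ltnP i j.
  rewrite (ltn_eqF lt_ij) big1 // => k _; rewrite A0 ?mulr0 //.
  by apply: leq_ltn_trans lt_ij; rewrite -ltnS.
set M := \matrix_(k < i.+1, l < i.+1) A k l.
have uM : M \in unitmx.
  rewrite unitmxE (_ : \det M = 1) ?unitr1 //.
  rewrite det_trig; last by apply/is_trig_mxP => k l lt_kl; rewrite mxE A0.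
  by rewrite big1 // => k _; rewrite mxE A1.
have := congr1 (fun X : 'M_i.+1 => X (inord i) (inord j)) (mulVmx uM).
rewrite !mxE -val_eqE /= !inordK // => <-.
apply: eq_bigr => k _; rewrite /infmx_inv -ltnS ltn_ord inord_val.
by rewrite !mxE inordK.
Qed.

Lemma unitriangular_inv (A : infmx) :
  unitriangular A -> unitriangular (infmx_inv A).
Proof.
move=> uA; have [A1 A0] := uA; split=> [i | i j lt_ij]; last first.
  by rewrite /infmx_inv leqNgt lt_ij.
have := infmx_mulVr uA i i; rewrite /infmx_mul /infmx1 eqxx big_ord_recr /=.
by rewrite A1 mulr1 big1 ?add0r // => k _; rewrite A0 ?mulr0.
Qed.

Lemma infmx_mulE (A B : infmx) (N i j : nat) : (i < N)%N ->
  unitriangular A -> infmx_mul A B i j = \sum_(k < N) A i k * B k j.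
Proof.
move=> ltiN [_ A0]; rewrite /infmx_mul -(big_mkord xpredT (fun k => A i k * B k j)).
rewrite -(big_mkord xpredT (fun k => A i k * B k j)).
rewrite [RHS](@big_cat_nat _ _ _ i.+1) //= [X in _ + X]big_nat_cond.
by rewrite [X in _ + X]big1 ?addr0 // => k /andP[/andP[lt_ik _] _]; rewrite A0 ?mul0r.
Qed.

Lemma infmx_mulA (A B C : infmx) : unitriangular A -> unitriangular B ->
  forall i j, infmx_mul A (infmx_mul B C) i j = infmx_mul (infmx_mul A B) C i j.
Proof.
move=> uA uB i j; rewrite {1 3}/infmx_mul.
under eq_bigr => k _ do rewrite (infmx_mulE _ _ (ltn_ord k) uB) big_distrr /=.
rewrite exchange_big /=; apply: eq_bigr => k _.
by rewrite /infmx_mul big_distrl /=; apply: eq_bigr => l _; rewrite mulrA.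
Qed.

Lemma infmx_mul1r (A : infmx) i j : infmx_mul infmx1 A i j = A i j.
Proof.
rewrite /infmx_mul big_ord_recr /= /infmx1 eqxx mul1r big1 ?add0r // => k _.
by rewrite gtn_eqF // mul0r.
Qed.

Lemma infmx_mulr1 (A : infmx) : unitriangular A ->
  forall i j, infmx_mul A infmx1 i j = A i j.
Proof.
move=> uA i j.
rewrite (@infmx_mulE _ _ (i + j).+1) ?ltnS ?leq_addr // /infmx1.
have lt_j : (j < (i + j).+1)%N by rewrite ltnS leq_addl.
rewrite (bigD1 (Ordinal lt_j)) //= eqxx mulr1 big1 ?addr0 // => k neq_kj.
by rewrite -val_eqE /= in neq_kj; rewrite (negPf neq_kj) mulr0.
Qed.

Lemma eq_infmx_mul (A A' B B' : infmx) :
  (forall i j, A i j = A' i j) -> (forall i j, B i j = B' i j) ->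
  forall i j, infmx_mul A B i j = infmx_mul A' B' i j.
Proof. by move=> eA eB i j; apply: eq_bigr => k _; rewrite eA eB. Qed.

Lemma infmx_mulrV (A : infmx) : unitriangular A ->
  forall i j, infmx_mul A (infmx_inv A) i j = infmx1 i j.
Proof.
move=> uA; set B := infmx_inv A; have uB : unitriangular B.
  exact: unitriangular_inv.
set C := infmx_inv B; have uC : unitriangular C by exact: unitriangular_inv.
have eCA i j : C i j = A i j.
  rewrite -(infmx_mulr1 uC) -[RHS]infmx_mul1r.
  rewrite -(eq_infmx_mul (infmx_mulVr uB) (fun _ _ => erefl)).
  rewrite -(infmx_mulA _ uC uB).
  by apply: eq_infmx_mul => // k l; rewrite (infmx_mulVr uA).
move=> i j; rewrite -(infmx_mulVr uB).
by apply: eq_infmx_mul => // k l; rewrite eCA.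
Qed.

Lemma infmx_inv_uniq (A B : infmx) : unitriangular A ->
  (forall i j, infmx_mul A B i j = infmx1 i j) ->
  forall i j, B i j = infmx_inv A i j.
Proof.
move=> uA AB i j; have uV := unitriangular_inv uA.
rewrite -(infmx_mulr1 uV) -[LHS]infmx_mul1r.
rewrite -(eq_infmx_mul (infmx_mulVr uA) (fun _ _ => erefl)).
by rewrite -(infmx_mulA _ uV uA); apply: eq_infmx_mul.
Qed.

Definition Ffact (F : nat -> rat) (n : nat) : rat := \prod_(1 <= i < n.+1) F i.

Definition Fnomial (F : nat -> rat) (n k : nat) : rat :=
  if (k <= n)%N then Ffact F n / (Ffact F k * Ffact F (n - k)%N) else 0.

Definition Fnomial_inv (F : nat -> rat) : infmx := infmx_inv (Fnomial F).

Lemma Fnomial_unitriangular (F : nat -> rat) :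
  (forall n, (0 < n)%N -> F n != 0) -> unitriangular (Fnomial F).
Proof.
move=> F0; split=> [i | i j lt_ij]; last by rewrite /Fnomial leqNgt lt_ij.
rewrite /Fnomial leqnn subnn [Ffact F 0]big_geq // mulr1 divff //.
by rewrite /Ffact big_nat prodf_seq_neq0; apply/allP=> k _; apply/implyP=> /andP[/F0].
Qed.

Definition Nseq (alpha n : nat) : rat := (n * alpha ^ n.-1)%:R.

Lemma Nseq_neq0 (alpha : nat) : (1 <= alpha)%N ->
  forall n, (0 < n)%N -> Nseq alpha n != 0.
Proof. by move=> a0 n n0; rewrite pnatr_eq0 -lt0n muln_gt0 n0 expn_gt0 a0. Qed.

(* [Nseq alpha n] is the coefficient of x^n in x / (1 - alpha x)^2. *)
Lemma Nseq_gf (alpha m n : nat) : (n < m)%N ->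
  ((1 - alpha%:R *: 'X) ^+ 2 * \poly_(i < m) Nseq alpha i)`_n = ('X : {poly rat})`_n.
Proof.
move=> lt_nm; set P := \poly_(i < m) _; set a : rat := alpha%:R.
have -> : (1 - a *: 'X) ^+ 2 * P = P - (2 * a) *: (P * 'X) + a ^+ 2 *: (P * 'X^2).
  by rewrite -!mul_polyC !polyCM polyC_natr; ring.
rewrite !coefE lt_nm; case: n lt_nm => [|[|n]] lt_nm.
- by rewrite /= /Nseq mul0n; ring.
- by rewrite /= (ltn_trans _ lt_nm) // /Nseq mul0n expn0 muln1; ring.
rewrite /= subn2 /= (ltn_trans _ lt_nm) // (ltn_trans _ lt_nm) //.
case: n lt_nm => [|n] _; rewrite /Nseq /= ?mul0n !natrM ?natrX -/a.
  by rewrite expr1 expr0; ring.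
by rewrite -[n.+3]addn3 -[n.+2]addn2 -[n.+1]addn1 !natrD !exprD; ring.
Qed.

(* A multigraph on n labeled vertices with indistinguishable parallel edges is
   its table of multiplicities: [m (i, j)] is the number of edges from i to j. *)
Definition multidigraph (alpha n : nat) := {ffun 'I_n * 'I_n -> 'I_alpha}.

Definition edge (alpha n : nat) (m : multidigraph alpha n) : rel 'I_n :=
  fun i j => (0 < m (i, j))%N.

(* A directed cycle has pairwise distinct vertices, hence length at most n;
   length 1 is a loop and length 2 a pair of opposite edges. *)
Definition acyclic (n : nat) (e : rel 'I_n) : bool :=
  [forall k : 'I_n, forall c : k.+1.-tuple 'I_n, ~~ ucycleb e c].

Lemma acyclicP (n : nat) (e : rel 'I_n) :
  reflect (forall c : seq 'I_n, c != [::] -> ~ ucycle e c) (acyclic e).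
Proof.
apply: (iffP forallP) => [ac [//|x c] _ uc | ac k].
  have lt_c : (size c < n)%N.
    have /andP[_ /card_uniqP /= <-] := uc.
    by rewrite -[X in (_ <= X)%N]card_ord max_card.
  by have /forallP/(_ (in_tuple (x :: c)))/negP := ac (Ordinal lt_c).
apply/forallP=> c; apply/negP; apply: ac.
by rewrite -size_eq0 size_tuple.
Qed.

(* At most alpha - 1 edges join two distinct vertices, both directions taken
   together; loops are excluded by acyclicity. *)
Definition alpha_dag (alpha n : nat) (m : multidigraph alpha n) : bool :=
  acyclic (edge m) &&
  [forall i, forall j, (i != j) ==> (m (i, j) + m (j, i) <= alpha.-1)%N].

Definition num_alpha_dag (alpha n : nat) : nat :=
  #|[set m : multidigraph alpha n | alpha_dag m]|.

Lemma num_alpha_dag0 (alpha : nat) : num_alpha_dag alpha 0 = 1%N.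
Proof.
rewrite /num_alpha_dag (_ : [set m | _] = [set: multidigraph alpha 0]).
  by rewrite cardsT card_ffun card_prod !card_ord.
apply/setP=> m; rewrite !inE; apply/andP.
by split; apply/forallP => -[].
Qed.

(* Main.v *)
Require Import Defs.
From mathcomp Require Import all_boot all_order all_algebra ring.

(* Sum (-1)^|S| over the pairs formed by an alpha-DAG on n > 0 vertices and a set
   S of its sources. For each DAG the sum over S vanishes, because the set of all
   its sources is not empty. For each S of size k, removing S leaves an arbitrary
   DAG on n - k vertices and arbitrary multiplicities in {0, ..., alpha - 1} for the
   k (n - k) pairs leaving S, so that
     sum_k (-1)^k C(n, k) alpha^(k (n - k)) A(n - k) = 0.
   Since C(n, k)_F = C(n, k) alpha^(k (n - k)) for F = N(alpha), this says that
   (-1)^n A(n) solves the triangular system defining column 0 of the inverse. *)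

Set Implicit Arguments.
Unset Strict Implicit.
Unset Printing Implicit Defensive.

Import Order.TTheory GRing.Theory Num.Theory.

Local Open Scope ring_scope.

(** * Acyclicity in terms of sources *)

Lemma fcycle_exists (T : finType) (f : T -> T) (x : T) :
  exists2 y, fconnect f x y & fcycle f (orbit f y).
Proof.
have /trajectP[i lt_i eq_i] := looping_order f x.
(* By pigeonhole the orbit of [x] closes up at its [i]-th iterate, which [order f x - i] further
   steps bring back to itself. *)
exists (iter i f x); first exact: fconnect_iter.
apply/(orbitPcycle 0 3); exists (order f x - i).-1.
by rewrite prednK ?subn_gt0 // -iterD subnK // ltnW.
Qed.

Lemma eq_acyclic (n : nat) (e e' : rel 'I_n) :
  e =2 e' -> acyclic e = acyclic e'.
Proof.
move=> ee'; apply: eq_forallb => k; apply: eq_forallb => c.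
by rewrite /ucycleb (eq_cycle ee').
Qed.

(** If [U] has no source, choosing a predecessor inside [U] defines a self-map of [U], and a cycle
    of that map is a directed cycle read backwards. Conversely, each vertex of a directed cycle has
    its predecessor on the same cycle, so the vertices of a cycle form a set without source. *)
Lemma acyclic_sourceP (n : nat) (e : rel 'I_n) :
  reflect (forall U : {set 'I_n}, U != set0 ->
             exists2 x, x \in U & {in U, forall y, ~~ e y x})
          (acyclic e).
Proof.
apply: (iffP (acyclicP e)) => [ac U /set0Pn[x0 Ux0] | src c c0 /andP[cyc _]].
  have [/existsP[x /andP[Ux /forall_inP nx]] | ] :=
    boolP [exists x in U, [forall y in U, ~~ e y x]]; first by exists x.
  rewrite negb_exists => /forallP nsrc.
  (* The default [x] is never reached on [U], where a predecessor in [U] always exists. *)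
  pose f x := odflt x [pick y in U | e y x].
  have fP x : x \in U -> f x \in U /\ e (f x) x.
    move=> Ux; rewrite /f; case: pickP => [y /andP[]//|none].
    have:= nsrc x; rewrite Ux /= => /forall_inPn[y Uy /negPn eyx].
    by have:= none y; rewrite /= Uy eyx.
  have fU x k : x \in U -> iter k f x \in U.
    by move=> Ux; elim: k => //= k /fP[].
  have [y /iter_findex <- cyc] := fcycle_exists f x0.
  move: (iter _ _ _) (fU _ (findex f x0 y) Ux0) cyc => {}y Uy cyc.
  case: (ac (rev (orbit f y))).
    by rewrite -size_eq0 size_rev size_orbit -lt0n order_gt0.
  rewrite /ucycle rev_uniq orbit_uniq andbT rev_cycle.
  apply: sub_in_cycle cyc => [u v Uu Uv /eqP <-|]; first by have [] := fP u Uu.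
  by apply/allP => u; rewrite -fconnect_orbit => /iter_findex <-; apply: fU.
have [|x] := src [set x in c].
  case: c c0 {cyc} => // x c _; apply/set0Pn; exists x.
  by rewrite inE mem_head.
rewrite inE => cx /(_ (prev c x)); rewrite inE mem_prev => /(_ cx)/negP; apply.
exact: prev_cycle.
Qed.

(** By the source criterion: a set that meets [S] has a source in [S], and a set that avoids [S] is
    the image under [h] of a set of vertices of the smaller graph. *)
Lemma acyclic_remove_sources (n k : nat) (e : rel 'I_n) (S : {set 'I_n})
    (h : 'I_k -> 'I_n) :
  {in S, forall x y, ~~ e y x} -> injective h -> h @: setT = ~: S ->
  acyclic e = acyclic (relpre h e).
Proof.
move=> srcS injh imh.
apply/acyclic_sourceP/acyclic_sourceP => src U.
  rewrite -(imset_eq0 h) => /src[_ /imsetP[x Ux ->] hx]; exists x => // y Uy.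
  by apply: hx; apply: imset_f.
have [/set0Pn[x /setIP[Ux Sx]] _ | /negPn/eqP US0 U0] := boolP (U :&: S != set0).
  by exists x => // y _; apply: srcS.
have UE : U = h @: (h @^-1: U).
  apply/setP => x; apply/idP/imsetP => [Ux | [y]]; last by rewrite inE => ? ->.
  have : x \in h @: setT.
    rewrite imh inE; apply: contraTN isT => Sx.
    by have : x \in U :&: S; [rewrite inE Ux | rewrite US0 inE].
  by case/imsetP=> y _ xE; exists y; rewrite // inE -xE.
have [|x] := src (h @^-1: U); first by rewrite -(imset_eq0 h) -UE.
rewrite inE => Ux hx; exists (h x) => // y.
by rewrite UE => /imsetP[z Uz ->]; apply: hx.
Qed.

(** One of [i], [j] is a source of the pair, so one of the two multiplicities is zero; the other is
    at most [alpha.-1] by its type. *)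
Lemma alpha_dagE (alpha n : nat) (m : multidigraph alpha n) :
  alpha_dag m = acyclic (edge m).
Proof.
apply: andb_idr => /acyclic_sourceP src.
apply/forallP => i; apply/forallP => j; apply/implyP => _.
have [|x] := src [set i; j]; first by apply/set0Pn; exists i; rewrite !inE eqxx.
have lt_m k : (m k <= alpha.-1)%N.
  by case: (m k) => v /= lt_v; rewrite -ltnS (ltn_predK lt_v).
rewrite !inE => /orP[] /eqP-> nox.
  have /negbTE := nox j (set22 i j).
  by rewrite /edge lt0n => /negbFE/eqP ->; rewrite addn0 lt_m.
have /negbTE := nox i (set21 i j).
by rewrite /edge lt0n => /negbFE/eqP ->; rewrite lt_m.
Qed.

(** * Counting DAGs with prescribed sources *)

Lemma card_ffun_extend (A B I : finType) (i0 : I) (h : A -> B) (W : {set B})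
    (P : pred {ffun A -> I}) : injective h -> (forall a, h a \in W) ->
  #|[set m : {ffun B -> I} | P [ffun a => m (h a)] &
      [forall b, (b \notin W) ==> (m b == i0)]]|
    = (#|[set p | P p]| * #|I| ^ (#|W| - #|A|))%N.
Proof.
move=> injh hW; rewrite -sum1_card.
rewrite (partition_big (fun m : {ffun B -> I} => [ffun a => m (h a)])
   (fun p => p \in [set p | P p])) /=; last first.
  by move=> m; rewrite !inE => /andP[].
rewrite -sum_nat_const; apply: eq_bigr => p; rewrite inE => Pp.
(* The functions restricting to [p] form a product of sets of allowed values: one value on the image
   of [h], one value [i0] outside [W], and all of [I] on the rest of [W]. *)
pose F (b : B) : pred I := fun v =>
  [forall a, (h a == b) ==> (v == p a)] && ((b \notin W) ==> (v == i0)).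
transitivity #|(family F : simpl_pred {ffun B -> I})|.
  rewrite -[RHS]sum1_card; apply: eq_bigl => m; rewrite !inE /=.
  apply/andP/forallP => [[/andP[_ /forallP m0] /eqP mp] b | mF].
    rewrite unfold_in m0 andbT; apply/forallP => a; apply/implyP => /eqP <-.
    by rewrite -mp ffunE.
  have mp : [ffun a => m (h a)] = p.
    apply/ffunP => a; rewrite ffunE.
    by have := mF (h a); rewrite unfold_in => /andP[/forallP/(_ a)]; rewrite eqxx => /eqP.
  rewrite mp Pp; split=> //; apply/forallP => b.
  by have := mF b; rewrite unfold_in => /andP[].
rewrite card_family foldrE big_image /=.
have -> : (#|W| - #|A| = #|W :\: h @: setT|)%N.
  rewrite cardsDS; last by apply/subsetP => _ /imsetP[a _ ->].
  by rewrite card_imset // cardsT.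
rewrite -prod_nat_const [RHS]big_mkcond /=.
apply: eq_bigr => b _; rewrite inE.
have [/imsetP[a _ ->] | nhb] /= := boolP (b \in _).
  rewrite -(card1 (p a)); apply: eq_card => v.
  rewrite [in RHS]inE -[LHS]/(F (h a) v) /F hW andbT.
  apply/forallP/eqP => [/(_ a)|-> a'].
    by rewrite eqxx => /eqP.
  by rewrite (inj_eq injh); apply/implyP => /eqP->.
have Fb v : F b v = ((b \notin W) ==> (v == i0)).
  rewrite /F [X in X && _](_ : _ = true) //; apply/forallP => a.
  by apply/implyP => /eqP hab; rewrite -hab imset_f in nhb.
case: (b \in W) Fb => /= Fb; first by apply: eq_card => v; rewrite -[LHS]/(F b v) Fb.
by rewrite -(card1 i0); apply: eq_card => v; rewrite -[LHS]/(F b v) Fb.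
Qed.

(** Here [W] consists of the pairs with head outside [S]. Those with tail outside [S] too carry the
    smaller DAG; the pairs from [S] to its complement are free, since edges leaving sources close no
    cycle. *)
Lemma num_alpha_dag_sources (a n : nat) (S : {set 'I_n}) :
  #|[set m : multidigraph a.+1 n |
      alpha_dag m & [forall i, forall j in S, m (i, j) == ord0]]|
    = (num_alpha_dag a.+1 (n - #|S|) * a.+1 ^ (#|S| * (n - #|S|)))%N.
Proof.
have -> : (n - #|S| = #|~: S|)%N by rewrite [RHS]cardsCs setCK card_ord.
set k := #|~: S|; pose h : 'I_k -> 'I_n := enum_val.
have injh : injective h by exact: enum_val_inj.
have imh : h @: setT = ~: S.
  apply/setP => x; apply/imsetP/idP => [[y _ ->] | Sx]; first exact: enum_valP.
  by exists (enum_rank_in Sx x); rewrite ?inE // /h enum_rankK_in.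
pose h2 (u : 'I_k * 'I_k) := (h u.1, h u.2).
pose W : {set 'I_n * 'I_n} := setX setT (~: S).
have hW u : h2 u \in W by rewrite inE inE /= -imh imset_f.
have injh2 : injective h2 by case=> u v [u' v'] [/injh-> /injh->].
have := card_ffun_extend ord0 (fun p : multidigraph a.+1 k => acyclic (edge p)) injh2 hW.
rewrite card_ord card_prod cardsX cardsT !card_ord -/k.
have -> : (n * k - k * k = #|S| * k)%N.
  by rewrite -mulnBl [#|S|]cardsCs card_ord.
rewrite /num_alpha_dag.
have -> : [set p : multidigraph a.+1 k | acyclic (edge p)] = [set m | alpha_dag m].
  by apply/setP => p; rewrite !inE alpha_dagE.
move=> <-; congr #|pred_of_set _|; apply/setP => m; rewrite !inE alpha_dagE.
have -> : [forall b, (b \notin W) ==> (m b == ord0)]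
          = [forall i, forall j in S, m (i, j) == ord0].
  apply/forallP/forallP => m0.
    by move=> i; apply/forall_inP => j Sj; have := m0 (i, j); rewrite !inE /= Sj.
  case=> i j; apply/implyP; rewrite !inE negbK /=.
  exact: (forall_inP (m0 i)).
apply: andb_id2r => /forallP m0; rewrite (acyclic_remove_sources _ injh imh).
  by apply: eq_acyclic => i j; rewrite /edge /= ffunE.
by move=> x Sx y; rewrite /edge (eqP (forall_inP (m0 y) x Sx)).
Qed.

(** * Signed sums over subsets and the recurrence for DAGs *)

Lemma sum_subset_card (R : nzRingType) (T : finType) (A : {set T}) (f : nat -> R) :
  \sum_(S : {set T} | S \subset A) f #|S| = \sum_(k < #|A|.+1) f k *+ 'C(#|A|, k).
Proof.
rewrite (partition_big (fun S : {set T} => inord #|S| : 'I_#|A|.+1) xpredT) //=.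
apply: eq_bigr => k _; rewrite -cards_draws -sumr_const.
apply: eq_big => S; rewrite ?inE.
  apply: andb_id2l => /subset_leq_card leSA.
  by rewrite -val_eqE /= inordK.
by case/andP=> /subset_leq_card leSA /eqP <-; rewrite inordK.
Qed.

(** This is the binomial expansion of [(1 - 1) ^+ #|A|] with a positive exponent. *)
Lemma sum_signed_subsets (R : nzRingType) (T : finType) (A : {set T}) :
  A != set0 -> \sum_(S : {set T} | S \subset A) (-1) ^+ #|S| = 0 :> R.
Proof.
move=> A0; rewrite sum_subset_card.
have := exprDn_comm #|A| (commr_sym (commr1 (-1 : R))).
rewrite subrr expr0n cards_eq0 (negPf A0) => sum0.
rewrite -[RHS]/(false%:R) sum0; by apply: eq_bigr => k _; rewrite expr1n mul1r.
Qed.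

Lemma num_alpha_dag_rec (a n : nat) : (0 < n)%N ->
  \sum_(k < n.+1) (-1) ^+ k *
     ('C(n, k) * (num_alpha_dag a.+1 (n - k) * a.+1 ^ (k * (n - k))))%:R = 0 :> rat.
Proof.
move=> n0.
pose src (m : multidigraph a.+1 n) := [set j | [forall i, m (i, j) == ord0]].
have : \sum_(m : multidigraph a.+1 n | alpha_dag m)
    \sum_(S : {set 'I_n} | S \subset src m) (-1) ^+ #|S| = 0 :> rat.
  apply: big1 => m; rewrite alpha_dagE => /acyclic_sourceP/(_ setT) [|x _ nox].
    by apply/set0Pn; exists (Ordinal n0).
  apply: sum_signed_subsets; apply/set0Pn; exists x; rewrite inE.
  apply/forallP => i; have := nox i (in_setT i).
  by rewrite /edge lt0n negbK.
(* With [S] outside, the inner sum counts the DAGs in which every vertex of [S] is a source, a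
   number that depends on [#|S|] only. *)
rewrite (exchange_big_dep xpredT) //=.
pose f k : rat := (-1) ^+ k * (num_alpha_dag a.+1 (n - k) * a.+1 ^ (k * (n - k)))%:R.
rewrite (eq_bigr (fun S : {set 'I_n} => f #|S|)) => [|S _]; last first.
  rewrite sumr_const /f -num_alpha_dag_sources mulr_natr; congr (_ *+ _).
  apply: eq_card => m; rewrite !inE; apply: andb_id2l => _.
  apply/subsetP/forallP => [sub i | m0 j Sj].
    by apply/forall_inP => j /sub; rewrite inE => /forallP.
  by rewrite inE; apply/forallP => i; apply: (forall_inP (m0 i)).
rewrite (eq_bigl (fun S : {set 'I_n} => S \subset [set: 'I_n])) => [|S]; last by rewrite subsetT.
rewrite sum_subset_card cardsT card_ord => sum0.
rewrite -[RHS]sum0; apply: eq_bigr => k _.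
by rewrite /f natrM mulrCA mulr_natl mulrnAr.
Qed.

(** * The F-nomial coefficients of N(alpha) *)

Lemma Ffact_Nseq (alpha n : nat) :
  Ffact (Nseq alpha) n = (n`! * alpha ^ 'C(n, 2))%:R.
Proof.
elim: n => [|n IHn]; first by rewrite /Ffact big_geq.
rewrite /Ffact big_nat_recr //= -/(Ffact _ n) IHn /Nseq /= -natrM factS binS bin1 expnD.
by congr _%:R; ring.
Qed.

Lemma Fnomial_Nseq (alpha n k : nat) : (0 < alpha)%N -> (k <= n)%N ->
  Fnomial (Nseq alpha) n k = ('C(n, k) * alpha ^ (k * (n - k)))%:R.
Proof.
move=> alpha0 le_kn; rewrite /Fnomial le_kn !Ffact_Nseq -natrM.
apply: canLR (mulfK _) _; first by rewrite pnatr_eq0 -lt0n !muln_gt0 !fact_gt0 !expn_gt0 alpha0.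
rewrite -natrM -(bin_fact le_kn).
(* Pairs in an n-set split by a k-subset: both elements inside, both outside, or one of each. The
   mixed pairs give the surviving power of [alpha]. *)
have -> : 'C(n, 2) = ('C(k, 2) + 'C(n - k, 2) + k * (n - k))%N.
  rewrite -{1}(subnKC le_kn); elim: (n - k)%N => [|m IHm].
    by rewrite addn0 muln0 !addn0.
  by rewrite addnS !binS !bin1 IHm mulnS; ring.
by rewrite !expnD; congr _%:R; ring.
Qed.

(** * Column 0 of the inverse matrix *)

Lemma infmx_inv_col (A : infmx) (b : nat -> rat) (j : nat) : unitriangular A ->
  (forall i, \sum_(k < i.+1) A i k * b k = (i == j)%:R) ->
  forall i, infmx_inv A i j = b i.
Proof.
move=> uA Ab; have [A1 _] := uA.
elim/ltn_ind => i IHi.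
(* Forward substitution: both columns satisfy the equation of row [i], agree below [i] by induction,
   and have coefficient 1 at [i]. *)
have := infmx_mulrV uA i j; rewrite /infmx_mul /infmx1 -(Ab i).
rewrite !big_ord_recr /= A1 !mul1r.
under eq_bigr => k _ do rewrite IHi //.
by move/addrI.
Qed.

Lemma Fnomial_inv_num_alpha_dag (alpha n : nat) : (0 < alpha)%N ->
  Fnomial_inv (Nseq alpha) n 0 = (-1) ^+ n * (num_alpha_dag alpha n)%:R.
Proof.
move=> alpha0.
apply: (infmx_inv_col (b := fun n => (-1) ^+ n * (num_alpha_dag alpha n)%:R)).
  exact/Fnomial_unitriangular/Nseq_neq0.
move=> {}n.
have [-> | n0] := posnP n.
  by rewrite big_ord1 Fnomial_Nseq // num_alpha_dag0 expr0 mulr1.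
case: alpha alpha0 => // a _.
have := num_alpha_dag_rec a n0.
(* The recurrence is indexed by the number of removed sources, the matrix row by the number of
   remaining vertices, hence the reversal. The factor [(-1) ^+ n] turns the sign [(-1) ^+ (n - k)]
   into [(-1) ^+ k]. *)
rewrite (reindex_inj rev_ord_inj) /= => /(congr1 ( *%R ((-1) ^+ n))).
rewrite mulr0 mulr_sumr => sum0; rewrite -[RHS]sum0; apply: eq_bigr => k _.
have le_kn : (k <= n)%N by rewrite -ltnS.
rewrite Fnomial_Nseq // subSS subKn // bin_sub // mulrA -exprD.
rewrite -[in RHS]signr_odd oddD oddB // addKb signr_odd.
by rewrite [(k * _)%N]mulnC !natrM; ring.
Qed.

Theorem theorem1 (alpha : nat) (halpha : (1 <= alpha)%N)
    (n : nat) (hn : (0 < n)%N) :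
  (num_alpha_dag alpha n)%:R = (-1) ^+ n * Fnomial_inv (Nseq alpha) n 0%N /\
  (-1) ^+ n * Fnomial_inv (Nseq alpha) n 0%N = `| Fnomial_inv (Nseq alpha) n 0%N |.
Proof.
rewrite Fnomial_inv_num_alpha_dag // signrMK normrMsign normr_nat.
by [].
Qed.
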